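(* Let $L$ be a finite geometric lattice, let $a$ be an atom of $L$, and let $n \geq 1$. Then $(L,a)$ has the full downward matching property for the $n$-element chain $[n]$, where the matchings can be taken to be $a$-invertible. That is, for every pair of filters $F \supseteq G$ of $[n]$ there is an $a$-invertible decreasing matching $\sigma : \mathrm{T}(L^{[n]}, F, a) \to \mathrm{T}(L^{[n]}, G, a)$.
   Context: A geometric lattice is an atomic (every element is a join of atoms) upper semimodular lattice, where upper semimodular means: if $u$ covers $v$ then for every $w$, $u \vee w$ covers $v \vee w$ or $u \vee w = v \vee w$. $[n] = \{1 < 2 < \dots < n\}$. For a poset $P$, $L^P$ is the set of order-preserving maps from $P$ to $L$, ordered pointwise. A filter of $P$ is an up-closed subset (possibly empty). For a filter $F$ of $P$ and a join-irreducible $a$, $\mathrm{T}(L^P, F, a) = \{f \in L^P \mid \text{for all } x \in P:\ f(x) \geq a \text{ iff } x \in F\}$. A decreasing matching from $Q_1$ to $Q_2$ (subsets of a poset) is a one-to-one map $\sigma: Q_1 \to Q_2$ with $\sigma(x) \leq x$ for all $x \in Q_1$. The pair $(L,a)$ has the full downward matching property for $P$ iff $a$ is join-irreducible and for all filters $F \supseteq G$ of $P$ there is a decreasing matching $\mathrm{T}(L^P, F, a) \to \mathrm{T}(L^P, G, a)$. A decreasing matching $\sigma : \mathrm{T}(L^P, F, a) \to \mathrm{T}(L^P, G, a)$ is $a$-invertible iff for every $f \in \mathrm{T}(L^P, F, a)$: $f(x) = \sigma(f)(x) \vee a$ for $x \in F$ and $f(x) = \sigma(f)(x)$ for $x \in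 P \setminus F$. *)

(* Defs.v *)
From HB Require Import structures.
From mathcomp Require Import all_boot all_order.

Set Implicit Arguments.
Unset Strict Implicit.
Unset Printing Implicit Defensive.

Import Order.TTheory.
Local Open Scope order_scope.

Definition covers d (L : finPOrderType d) (u v : L) : bool :=
  (v < u) && [forall w : L, ~~ (v < w < u)].

Definition atom d (L : finTBLatticeType d) (a : L) : bool := covers a \bot.

(* The bottom element is the join of the empty set of atoms. *)
Definition atomic d (L : finTBLatticeType d) : Prop :=
  forall x : L, exists2 A : {set L},
    {in A, forall a, atom a} & x = \join_(a in A) a.

Definition upper_semimodular d (L : finTBLatticeType d) : Prop :=
  forall u v w : L, covers u v ->
    covers (u `|` w) (v `|` w) \/ u `|` w = v `|` w.

Definition geometric d (L : finTBLatticeType d) : Prop :=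
  atomic L /\ upper_semimodular L.

Definition join_irreducible d (L : finTBLatticeType d) (a : L) : Prop :=
  a <> \bot /\ forall x y : L, a = x `|` y -> a = x \/ a = y.

Definition is_filter d (P : finPOrderType d) (F : {set P}) : Prop :=
  forall x y : P, x \in F -> x <= y -> y \in F.

(* The poset L^P.  Monotone maps are carried by {ffun P -> L} so that equality
   of elements is extensional. *)
Section MonotoneMaps.
Context {dP dL : Order.disp_t}.
Variables (P : finPOrderType dP) (L : finPOrderType dL).

Record mono_map : Type := MonoMap {
  mono_val :> {ffun P -> L};
  mono_valP : [forall x, forall y, (x <= y) ==> (mono_val x <= mono_val y)]
}.

HB.instance Definition _ := [isSub for mono_val].
HB.instance Definition _ := [Finite of mono_map by <:].

Definition mono_le (f g : mono_map) : bool := [forall x, f x <= g x].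

Lemma mono_le_refl : reflexive mono_le.
Proof. by move=> f; apply/forallP. Qed.

Lemma mono_le_anti : antisymmetric mono_le.
Proof.
move=> f g /andP[/forallP fg /forallP gf]; apply/val_inj/ffunP => x.
by apply/le_anti; rewrite fg gf.
Qed.

Lemma mono_le_trans : transitive mono_le.
Proof.
move=> g f h /forallP fg /forallP gh; apply/forallP => x.
exact: le_trans (fg x) (gh x).
Qed.

Fact mono_display : Order.disp_t. Proof. exact: Order.Disp tt tt. Qed.

HB.instance Definition _ := Order.Le_isPOrder.Build mono_display mono_map
  mono_le_refl mono_le_anti mono_le_trans.

End MonotoneMaps.

Definition Tset dP (P : finPOrderType dP) dL (L : finPOrderType dL)
    (F : {set P}) (a : L) : {set mono_map P L} :=
  [set f : mono_map P L | [forall x, (a <= f x) == (x \in F)]].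

(* A map Q1 -> Q2 is a total function on the ambient poset, constrained only
   on Q1. *)
Definition decreasing_matching d (Q : finPOrderType d) (Q1 Q2 : {set Q})
    (s : Q -> Q) : Prop :=
  [/\ {in Q1, forall x, s x \in Q2},
      {in Q1 &, injective s}
    & {in Q1, forall x, s x <= x}].

Definition full_downward_matching_property dP (P : finPOrderType dP)
    dL (L : finTBLatticeType dL) (a : L) : Prop :=
  join_irreducible a /\
  forall F G : {set P}, is_filter F -> is_filter G -> G \subset F ->
    exists s : mono_map P L -> mono_map P L,
      decreasing_matching (Tset F a) (Tset G a) s.

Definition invertible_matching dP (P : finPOrderType dP)
    dL (L : finTBLatticeType dL) (F : {set P}) (a : L)
    (s : mono_map P L -> mono_map P L) : Prop :=
  {in Tset F a, forall f : mono_map P L,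
    (forall x, x \in F -> f x = s f x `|` a) /\
    (forall x, x \notin F -> f x = s f x)}.

(* Main.v *)
(* A map [g] with [f = g `|` a] on [F] and [f = g] off [F] determines [f], so
   injectivity of an invertible matching is automatic, and it suffices to find
   for each [f] one such [g] in [T(L^[n], G, a)].  The values of [g] on the
   interval [F \ G] of the chain are chosen greedily from left to right: an
   element [z] maximal between the previous value [y] and [x := f i] among those
   not above [a] satisfies [z `|` a = x].  Otherwise [x] has an atom [p] not
   below [z `|` a]; by maximality [z < z `|` a <= z `|` p], and [z `|` p] covers
   [z], so that [p <= z `|` p = z `|` a]. *)
Require Import Defs.
From mathcomp Require Import all_boot all_order.

Set Implicit Arguments.
Unset Strict Implicit.
Unset Printing Implicit Defensive.

Import Order.TTheory.
Local Open Scope order_scope.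

Lemma coversW d (L : finPOrderType d) (u v w : L) :
  covers u v -> v <= w -> w <= u -> w = v \/ w = u.
Proof.
move=> /andP[_ /forallP/(_ w)]; rewrite negb_and => + vw wu.
rewrite !lt_neqAle vw wu !andbT !negbK.
by case/orP => /eqP ->; [left | right].
Qed.

Lemma atom_join_irreducible d (L : finTBLatticeType d) (a : L) :
  atom a -> join_irreducible a.
Proof.
move=> atom_a; split=> [a0 | x y axy].
  by move: atom_a; rewrite /atom /covers a0 ltxx.
have xa : x <= a by rewrite axy leUl.
have [x0 | ->] := coversW atom_a (le0x x) xa; last by left.
by right; rewrite axy x0 join0x.
Qed.

Lemma atomic_witness d (L : finTBLatticeType d) (x z : L) :
  atomic L -> ~~ (x <= z) -> exists p : L, [/\ atom p, p <= x & ~~ (p <= z)].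
Proof.
move=> atomicL xz; have [A atomA xE] := atomicL x.
have [/forall_inP Az | ] := boolP [forall p in A, p <= z].
  by case/negP: xz; rewrite xE; apply/joinsP.
rewrite negb_forall_in => /exists_inP[p pA pz]; exists p; split=> //.
  exact: atomA.
by rewrite xE; apply: (joins_min pA).
Qed.

Section AvoidingLift.
Context {d : Order.disp_t} {L : finTBLatticeType d}.
Variable a : L.

Definition is_avoiding_lift (y x z : L) : bool :=
  [&& y <= z, ~~ (a <= z) & z `|` a == x].

(* The default [y] is irrelevant: it is returned only when there is no lift. *)
Definition avoiding_lift (y x : L) : L :=
  odflt y [pick z | is_avoiding_lift y x z].

Lemma avoiding_liftP (y x : L) : geometric L -> ~~ (a <= y) -> y `|` a <= x ->
  is_avoiding_lift y x (avoiding_lift y x).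
Proof.
move=> [atomicL semiL] ay yax; rewrite /avoiding_lift.
case: pickP => //= no_lift.
have yx : y <= x by apply: le_trans yax; rewrite leUl.
have ax : a <= x by apply: le_trans yax; rewrite leUr.
pose P z := [&& y <= z, z <= x & ~~ (a <= z)].
have Py : P y by rewrite /P lexx yx.
(* The size of the principal ideal is strictly monotone in [w], so an element of [P] that maximizes
   it is maximal in the order of [L]. *)
pose D (w : L) := #|[set v | v <= w]|.
have [z /and3P[yz zx az] zmax] := arg_maxnP D Py.
have zmaxP w : z < w -> w <= x -> a <= w.
  move=> zw wx; apply: contraLR zw => aw; apply/negP => zw.
  have Pw : P w by rewrite /P (le_trans yz (ltW zw)) wx aw.
  suff : (D z < D w)%N by apply/negP; rewrite -leqNgt; apply: zmax.
  apply/proper_card/properP; split.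
    by apply/subsetP => v; rewrite !inE => /le_trans; apply; apply: ltW.
  by exists w; rewrite inE ?lexx // lt_geF.
have := no_lift z; rewrite /is_avoiding_lift yz az eq_le leUx zx ax /=.
move=> /negbT /(atomic_witness atomicL)[p [atom_p px pza]].
have pz : ~~ (p <= z) by apply: contra pza => /le_trans; apply; rewrite leUl.
have zp : z < p `|` z.
  by rewrite lt_neqAle leUr andbT eq_sym; apply: contra pz => /eqP/join_idPr.
have azp : a <= p `|` z by apply: zmaxP; rewrite // leUx px zx.
(* Since [p] covers [\bot], joining both with [z] gives that [p]|[z] covers [z] or equals it; [zp]
   excludes equality. *)
have := semiL _ _ z atom_p; rewrite join0x => -[zcov | pzE]; last first.
  by rewrite pzE ltxx in zp.
have zap : z `|` a <= p `|` z by rewrite leUx leUr.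
have [zaE | zaE] := coversW zcov (leUl z a) zap.
  by case/negP: az; rewrite -zaE leUr.
by case/negP: pza; rewrite zaE leUl.
Qed.

(** The predicate [c] marks the indices whose value has to avoid [a]. Each lift starts from the
    previous value already chosen, which keeps the new sequence monotone; [\bot] serves as the value
    before index 0. *)
Fixpoint lift_chain (c : pred nat) (x : nat -> L) (k : nat) : L :=
  if c k then
    avoiding_lift (if k is k'.+1 then lift_chain c x k' else \bot) (x k)
  else x k.

(** The last hypothesis makes every run of marked indices start at 0 or just after a value avoiding
    [a]. By induction along the run, each lift then starts from an element not above [a], as
    [avoiding_liftP] requires. *)
Lemma lift_chainP (c : pred nat) (x : nat -> L) : geometric L -> a != \bot ->
    {homo x : i j / (i <= j)%N >-> i <= j} -> (forall k, c k -> a <= x k) ->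
    (forall k, c k.+1 -> c k || ~~ (a <= x k)) ->
  [/\ {homo lift_chain c x : i j / (i <= j)%N >-> i <= j},
      forall k, c k -> ~~ (a <= lift_chain c x k)
                       /\ lift_chain c x k `|` a = x k
    & forall k, ~~ c k -> lift_chain c x k = x k].
Proof.
move=> geomL a0 x_homo ax c_pred.
have off k : ~~ c k -> lift_chain c x k = x k by case: k => [|k] /= /negPf ->.
have on k : c k ->
    is_avoiding_lift (if k is k'.+1 then lift_chain c x k' else \bot) (x k)
      (lift_chain c x k).
  elim: k => [|k IHk] ck; rewrite /= ck; apply: avoiding_liftP => //.
  - by rewrite lex0.
  - by rewrite join0x ax.
  - have [/IHk/and3P[] // | /[dup] /off -> nck] := boolP (c k).
    by move: (c_pred k ck); rewrite (negPf nck).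
  - rewrite leUx ax // andbT.
    apply: le_trans (x_homo _ _ (leqnSn k)).
    by have [/IHk/and3P[_ _ /eqP <-] | /off ->] := boolP (c k); rewrite ?leUl.
have le_x k : lift_chain c x k <= x k.
  by have [/on/and3P[_ _ /eqP <-] | /off ->] := boolP (c k); rewrite ?leUl.
split=> // [|k /on/and3P[_ ? /eqP]//].
(* Consecutive indices suffice: a lift lies above the value it starts from, and an unmarked [x k.+1]
   lies above [x k], hence above the previous new value. *)
apply: homo_leq => // [|k]; first exact: le_trans.
have [/on/and3P[] // | /off ->] := boolP (c k.+1).
exact: le_trans (le_x k) (x_homo _ _ (leqnSn k)).
Qed.

End AvoidingLift.

Lemma mono_mapP dP (P : finPOrderType dP) dL (L : finPOrderType dL)
    (f : mono_map P L) (x y : P) : x <= y -> f x <= f y.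
Proof. by have /forallP/(_ x)/forallP/(_ y)/implyP := mono_valP f. Qed.

Lemma in_Tset dP (P : finPOrderType dP) dL (L : finPOrderType dL) (F : {set P})
    (a : L) (f : mono_map P L) :
  reflect (forall x, (a <= f x) = (x \in F)) (f \in Tset F a).
Proof. by rewrite inE; apply: forallPP => x; apply: eqP. Qed.

(** The element [g] is a preimage of [f] under joining [a] on [F]; the boolean form lets [pick]
    select one. *)
Definition is_preimage dP (P : finPOrderType dP) dL (L : finTBLatticeType dL)
    (F G : {set P}) (a : L) (f g : mono_map P L) : bool :=
  (g \in Tset G a) && [forall x, f x == if x \in F then g x `|` a else g x].

Lemma ord_preimage_exists d (L : finTBLatticeType d) (a : L) (n : nat)
    (F G : {set 'I_n.+1}) (f : mono_map 'I_n.+1 L) :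
  geometric L -> atom a -> is_filter G -> G \subset F -> f \in Tset F a ->
  exists g, is_preimage F G a f g.
Proof.
move=> geomL atom_a filterG GF /in_Tset fF.
(* Indices past [n] are truncated to [n], which keeps the chain monotone. *)
pose o k : 'I_n.+1 := inord (minn k n).
have valo k : o k = minn k n :> nat by rewrite inordK // ltnS geq_minr.
have o_ord (i : 'I_n.+1) : o i = i.
  by apply: ord_inj; rewrite valo; apply/minn_idPl; rewrite -ltnS.
have o_homo i j : (i <= j)%N -> o i <= o j.
  by move=> ij; rewrite leEord !valo leq_min geq_minr geq_min ij.
pose c k := o k \in F :\: G; pose x k := f (o k).
have [||k|k|g_homo gon goff] := @lift_chainP _ _ a c x geomL.
- by case: (atom_join_irreducible atom_a) => /eqP.
- by move=> i j ij; apply/mono_mapP/o_homo.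
- by rewrite /c inE /x fF => /andP[].
(* If [o k] were in [G], then so would be [o k.+1], as [G] is up-closed. So [o k] is either in
   [F :\: G] or outside [F], where [f] avoids [a]. *)
- rewrite /c /x !inE fF => /andP[oG _]; case: (o k \in F); rewrite ?orbT //.
  rewrite andbT orbF; apply: contra oG => oG.
  exact: filterG oG (o_homo _ _ (leqnSn k)).
set y := lift_chain a c x in g_homo gon goff.
have g_mono : [forall i : 'I_n.+1, forall j : 'I_n.+1, (i <= j) ==>
    ([ffun i : 'I_n.+1 => y i] i <= [ffun i : 'I_n.+1 => y i] j)].
  apply/forallP => i; apply/forallP => j; apply/implyP => ij.
  by rewrite !ffunE; apply: g_homo.
exists (MonoMap g_mono); apply/andP; split.
  apply/in_Tset => i; rewrite ffunE.
  have [ci | nci] := boolP (c i).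
    have [/negPf -> _] := gon i ci.
    by move: ci; rewrite /c o_ord inE => /andP[/negPf ->].
  rewrite goff // /x o_ord fF.
  move: nci; rewrite /c o_ord inE negb_and negbK.
  by case: (boolP (i \in G)) => [/(subsetP GF) // | _ /= /negPf].
apply/forallP => i; rewrite ffunE; apply/eqP.
have [ci | nci] := boolP (c i).
  have [_ ->] := gon i ci; rewrite /x o_ord.
  by move: ci; rewrite /c o_ord inE => /andP[_ ->].
(* Off [F :\: G] the value is unchanged; on [F] it is already above [a], so the join with [a] is
   harmless. *)
rewrite goff // /x o_ord; case: ifP => // iF.
by rewrite join_l // fF.
Qed.

Lemma invertible_matching_of_preimages dP (P : finPOrderType dP)
    dL (L : finTBLatticeType dL) (F G : {set P}) (a : L) :
    {in Tset F a, forall f, exists g, is_preimage F G a f g} ->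
  exists s : mono_map P L -> mono_map P L,
    decreasing_matching (Tset F a) (Tset G a) s /\ invertible_matching F a s.
Proof.
(* The default [f] is taken only outside [Tset F a], where nothing is required of [s]. *)
move=> ex; pose s f := odflt f [pick g | is_preimage F G a f g].
have sP f : f \in Tset F a -> is_preimage F G a f (s f).
  by move=> /ex[g fg]; rewrite /s; case: pickP => //= /(_ g); rewrite fg.
have sE f x : f \in Tset F a -> f x = if x \in F then s f x `|` a else s f x.
  by move=> /sP/andP[_ /forallP/(_ x)/eqP].
exists s; split; first split.
- by move=> f /sP/andP[].
- move=> f g fT gT sfg; apply/val_inj/ffunP => x.
  by rewrite /= (sE f) // (sE g) // sfg.
- move=> f fT; apply/forallP => x; rewrite (sE f x fT).
  by case: ifP; rewrite ?leUl.
- by move=> f fT; split=> x xF; rewrite {1}(sE f x fT) ?xF ?(negPf xF).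
Qed.

Theorem theorem4p7p9 (d : Order.disp_t) (L : finTBLatticeType d) (a : L)
    (n : nat) (geomL : geometric L) (atom_a : atom a) (n_gt0 : (0 < n)%N) :
  full_downward_matching_property 'I_n a /\
  forall F G : {set 'I_n}, is_filter F -> is_filter G -> G \subset F ->
    exists s : mono_map 'I_n L -> mono_map 'I_n L,
      decreasing_matching (Tset F a) (Tset G a) s /\
      invertible_matching F a s.
Proof.
have matching (F G : {set 'I_n}) : is_filter G -> G \subset F ->
    exists s : mono_map 'I_n L -> mono_map 'I_n L,
      decreasing_matching (Tset F a) (Tset G a) s /\
      invertible_matching F a s.
  case: n n_gt0 F G => // m _ F G filterG GF.
  apply: invertible_matching_of_preimages => f fT.
  exact: ord_preimage_exists.
split=> [|F G _ filterG GF]; last exact: matching.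
split=> [|F G _ filterG GF]; first exact: atom_join_irreducible.
by have [s []] := matching F G filterG GF; exists s.
Qed.
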